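(* Let $L=2^n$ with $n\ge 1$ an integer, and consider Code 1 (defined in the context) on the three-dimensional periodic lattice $\mathbb{Z}_L^3$. For any site $u$, define recursively $E^{(0)}_u=XI_u$ and $$E^{(p+1)}_u=E^{(p)}_u\,E^{(p)}_{u+2^p\hat{x}}\,E^{(p)}_{u+2^p\hat{y}}\,E^{(p)}_{u+2^p\hat{z}},\qquad p\ge 0 .$$ Then $E^{(n)}_u$ is a logical operator of Code 1, and its energy barrier is at most $4+4\log_2 L$; that is, there is a sequence of single-qubit Pauli operators with product $E^{(n)}_u$ such that every intermediate state (obtained by applying an initial segment of the sequence to a ground state) has at most $4+4\log_2 L$ defects.
   Context: **Code 1.** Sites are the points of $\mathbb{Z}_L^3$ (periodic boundary conditions) with unit vectors $\hat x,\hat y,\hat z$; there are two qubits at each site. For single-qubit Pauli operators $P,Q\in\{I,X,Y,Z\}$, $PQ_u$ denotes $P\otimes Q$ acting on the (first, second) qubit at site $u$. For each elementary cube, labelled by its vertex $v$ (the vertices being $v+i\hat x+j\hat y+k\hat z$, $i,j,k\in\{0,1\}$), there are two stabilizer generators: - $Z$-type: the operator acting as $ZI$ at $v+\hat x+\hat y$, $v+\hat x+\hat z$, $v+\hat y+\hat z$; as $IZ$ at $v+\hat x$, $v+\hat y$, $v+\hat z$; as $ZZ$ at $v+\hat x+\hat y+\hat z$; and as $II$ at $v$. - $X$-type: the operator acting as $XI$ at $v+\hat x+\hat y$, $v+\hat x+\hat z$, $v+\hat y+\hat z$; as $IX$ at $v+\hat x$, $v+\hat y$, $v+\hat z$; as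 $XX$ at $v$; and as $II$ at $v+\hat x+\hat y+\hat z$. All generators $G_a$ commute pairwise; the Hamiltonian is $H=-\sum_a G_a$, and $\mathcal{G}$ denotes the group generated by the $G_a$ (stabilizers). Ground states $\psi_0$ satisfy $G_a\psi_0=\psi_0$ for all $a$. For a Pauli operator $E$, the defects of the state $E\psi_0$ are the generators $G_a$ that anticommute with $E$. A logical operator is a Pauli operator that commutes with all $G_a$ but does not belong to $\mathcal{G}$ (up to phase). *)

(* Defs.v *)
From mathcomp Require Import all_boot all_order all_algebra.
Set Implicit Arguments.
Unset Strict Implicit.
Unset Printing Implicit Defensive.
Import Order.TTheory GRing.Theory Num.Theory.
Local Open Scope ring_scope.

(* 'Z_L is the ring of integers mod L only for L >= 2. *)
Notation site L := ('Z_L * 'Z_L * 'Z_L)%type.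

Definition ex (L : nat) : site L := (1, 0, 0).
Definition ey (L : nat) : site L := (0, 1, 0).
Definition ez (L : nat) : site L := (0, 0, 1).


(* (u, false) and (u, true) are the first and the second qubit at u. *)
Notation qubit L := (site L * bool)%type.

(* The computational basis of the Hilbert space of all the qubits. *)
Notation config L := {ffun qubit L -> 'I_2}.

(* Operators on the Hilbert space, as matrices in the computational basis. *)
Notation operator C L := 'M[C]_#|{: config L}|.

Inductive pauli : Type := PI | PX | PY | PZ.

Definition pauli_mx (C : numClosedFieldType) (P : pauli) : 'M[C]_2 :=
  match P with
  | PI => 1%:M
  | PX => \matrix_(i, j) (i != j)%:R
  | PY => \matrix_(i, j) ((i != j)%:R * (if i == 0 then - 'i else 'i))
  | PZ => \matrix_(i, j) ((i == j)%:R * (if i == 0 then 1 else -1))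
  end.

(* The tensor product over all qubits q of the Pauli matrices f q. *)
Definition pauli_tensor (C : numClosedFieldType) (L : nat)
    (f : qubit L -> pauli) : operator C L :=
  \matrix_(s, t) \prod_(q : qubit L)
     pauli_mx C (f q) ((enum_val s : config L) q) ((enum_val t : config L) q).

Definition is_pauli (C : numClosedFieldType) (L : nat)
    (M : operator C L) : Prop :=
  exists (c : C) (f : qubit L -> pauli),
    c ^+ 4 = 1 /\ M = c *: pauli_tensor C f.

Definition single_qubit (C : numClosedFieldType) (L : nat)
    (q : qubit L) (P : pauli) : operator C L :=
  pauli_tensor C (fun r => if r == q then P else PI).

(* The operator PQ_u. *)
Definition two_qubit (C : numClosedFieldType) (L : nat)
    (P Q : pauli) (u : site L) : operator C L :=
  pauli_tensor C (fun r => if r.1 == u then (if r.2 then Q else P) else PI).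

(* For L >= 2 the eight vertices of a cube are distinct, so the factors of the
   following products act on distinct sites. *)
Definition Zgen (C : numClosedFieldType) (L : nat) (v : site L) :
    operator C L :=
  let x := ex L in let y := ey L in let z := ez L in
  two_qubit C PZ PI (v + x + y) *m two_qubit C PZ PI (v + x + z)
    *m two_qubit C PZ PI (v + y + z)
    *m two_qubit C PI PZ (v + x) *m two_qubit C PI PZ (v + y)
    *m two_qubit C PI PZ (v + z)
    *m two_qubit C PZ PZ (v + x + y + z).

Definition Xgen (C : numClosedFieldType) (L : nat) (v : site L) :
    operator C L :=
  let x := ex L in let y := ey L in let z := ez L in
  two_qubit C PX PI (v + x + y) *m two_qubit C PX PI (v + x + z)
    *m two_qubit C PX PI (v + y + z)
    *m two_qubit C PI PX (v + x) *m two_qubit C PI PX (v + y)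
    *m two_qubit C PI PX (v + z)
    *m two_qubit C PX PX v.

(* inl v and inr v label the Z-type and the X-type generator of the cube v. *)
Notation gen_label L := (site L + site L)%type.

Definition gen (C : numClosedFieldType) (L : nat) (a : gen_label L) :
    operator C L :=
  match a with inl v => Zgen C v | inr v => Xgen C v end.

Inductive stabilizer (C : numClosedFieldType) (L : nat) :
    operator C L -> Prop :=
  | stabilizer_gen (a : gen_label L) : stabilizer (gen C a)
  | stabilizer_one : stabilizer 1%:M
  | stabilizer_mul (M N : operator C L) :
      stabilizer M -> stabilizer N -> stabilizer (M *m N)
  | stabilizer_inv (M : operator C L) : stabilizer M -> stabilizer (invmx M).

Definition is_logical (C : numClosedFieldType) (L : nat)
    (M : operator C L) : Prop :=
  [/\ is_pauli M,
      forall a : gen_label L, comm_mx (gen C a) M &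
      forall c : C, `|c| = 1 -> ~ stabilizer (c *: M)].

(* The defects of the state M psi0, for any ground state psi0. *)
Definition defects (C : numClosedFieldType) (L : nat) (M : operator C L) :
    {set gen_label L} :=
  [set a | gen C a *m M == - (M *m gen C a)].

(* The head of the sequence is applied first: the product of
   [:: P1; P2; P3] is P3 P2 P1. *)
Fixpoint path_op (C : numClosedFieldType) (L : nat)
    (s : seq (qubit L * pauli)) : operator C L :=
  match s with
  | [::] => 1%:M
  | a :: s' => path_op C s' *m single_qubit C a.1 a.2
  end.

Definition energy_barrier_le (C : numClosedFieldType) (L : nat)
    (M : operator C L) (K : nat) : Prop :=
  exists s : seq (qubit L * pauli),
    path_op C s = M /\
    forall k : nat, (k <= size s)%N ->
      (#|defects (path_op C (take k s))| <= K)%N.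

Fixpoint Eop (C : numClosedFieldType) (L : nat) (p : nat) (u : site L) :
    operator C L :=
  match p with
  | 0%N => two_qubit C PX PI u
  | p'.+1 =>
      Eop C p' u *m Eop C p' (u + ex L *+ 2 ^ p')
        *m Eop C p' (u + ey L *+ 2 ^ p') *m Eop C p' (u + ez L *+ 2 ^ p')
  end.

(* Main.v *)
Require Import Defs.
From mathcomp Require Import all_boot all_order all_algebra.
From mathcomp Require Import ring zify.
Import Order.TTheory GRing.Theory Num.Theory.
Local Open Scope ring_scope.

(** In the group algebra over F_2 of the lattice, the Z-type defects of [XI_u]
    form [w (1 + x + y + z)] with [w = u - x - y - z], so those of [E^(p)_u]
    form [w (1 + x + y + z)^(2^p) = w (1 + x^(2^p) + y^(2^p) + z^(2^p))], which
    vanishes for [2^p = L].  Building [E^(p+1)] out of its four copies of [E^(p)]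
    one after the other, one finds that the defects [P] of every proper initial
    segment of [E^(p)] satisfy [|w + P| <= 1 + 4 p]: the point [w], and the base point of the copy under
    construction, belong to the defects of the copies already completed, and
    what these completed copies contribute besides has at most 4 points.
    Finally, [ZI] applied on the plane [z = u_z] commutes with every generator
    but meets [E^(n)_u] in an odd number of sites, since the projection of
    [E^(n)_u] on the [z] axis is [prod_(p < n) (1 + z^(2^p)) = sum_(i < L) z^i];
    so [E^(n)_u] is not a stabilizer. *)

(** * Tensor products of Pauli matrices and commutation up to sign *)

Section TensorProducts.
Variables (C : numClosedFieldType) (L : nat).
Implicit Types (F G : qubit L -> 'M[C]_2) (S T : qubit L -> bool).

Definition tensor F : operator C L :=
  \matrix_(s, t) \prod_(q : qubit L)
     F q ((enum_val s : config L) q) ((enum_val t : config L) q).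

Lemma eq_tensor F G : F =1 G -> tensor F = tensor G.
Proof.
by move=> eqFG; apply/matrixP=> s t; rewrite !mxE; apply: eq_bigr => q _;
  rewrite eqFG.
Qed.

Lemma tensor_mulmx F G : tensor F *m tensor G = tensor (fun q => F q *m G q).
Proof.
apply/matrixP=> s t; rewrite !mxE.
under [RHS]eq_bigr do rewrite mxE.
(* A product over qubits of two-term sums expands into a sum over configurations, which are the
   intermediate basis states of the matrix product. *)
rewrite bigA_distr_bigA (reindex _ (onW_bij _ (@enum_val_bij (config L)))) /=.
by apply: eq_bigr => r _; rewrite !mxE -big_split.
Qed.

Lemma tensor1 : tensor (fun=> 1%:M) = 1%:M.
Proof.
apply/matrixP=> s t; rewrite !mxE -(inj_eq enum_val_inj).
have [-> | neq_st] := eqVneq; first by rewrite big1 // => q _; rewrite mxE eqxx.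
have [q neq_q] : exists q, enum_val s q != enum_val t q.
  apply/existsP; apply: contraR neq_st; rewrite negb_exists => /forallP eq_st.
  by apply/eqP/ffunP => q; apply/eqP; have := eq_st q; rewrite negbK.
by rewrite (bigD1 q) //= mxE (negbTE neq_q) mul0r.
Qed.

Lemma tensor_scale (c : qubit L -> C) F :
  tensor (fun q => c q *: F q) = (\prod_q c q) *: tensor F.
Proof.
by apply/matrixP=> s t; rewrite !mxE -big_split; apply: eq_bigr => q _;
  rewrite mxE.
Qed.

Definition Xtensor S : operator C L :=
  pauli_tensor C (fun q => if S q then PX else PI).
Definition Ztensor S : operator C L :=
  pauli_tensor C (fun q => if S q then PZ else PI).

Lemma ord2_cases (P : 'I_2 -> Prop) : P 0 -> P 1 -> forall i, P i.
Proof.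
move=> P0 P1 [[|[|//]] i2].
- by have -> : Ordinal i2 = 0 by apply: val_inj.
- by have -> : Ordinal i2 = 1 by apply: val_inj.
Qed.

Lemma mulXX : pauli_mx C PX *m pauli_mx C PX = 1%:M.
Proof.
apply/matrixP; elim/ord2_cases; elim/ord2_cases;
  by rewrite !mxE !big_ord_recl big_ord0 !mxE /= ?mulr0 ?mul0r ?addr0 ?add0r ?mulr1.
Qed.

Lemma mulZZ : pauli_mx C PZ *m pauli_mx C PZ = 1%:M.
Proof.
apply/matrixP; elim/ord2_cases; elim/ord2_cases;
  rewrite !mxE !big_ord_recl big_ord0 !mxE /=; ring.
Qed.

Lemma mulZX : pauli_mx C PZ *m pauli_mx C PX = - (pauli_mx C PX *m pauli_mx C PZ).
Proof.
apply/matrixP; elim/ord2_cases; elim/ord2_cases;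
  rewrite !mxE !big_ord_recl !big_ord0 !mxE /=; ring.
Qed.

Lemma Xtensor_mul S T : Xtensor S *m Xtensor T = Xtensor (fun q => S q (+) T q).
Proof.
rewrite /Xtensor [LHS]tensor_mulmx; apply: eq_tensor => q.
by case: (S q) (T q) => [] [] /=; rewrite ?mulXX ?mul1mx ?mulmx1.
Qed.

Lemma Xtensor_comm S T : comm_mx (Xtensor S) (Xtensor T).
Proof.
rewrite /comm_mx !Xtensor_mul; apply: eq_tensor => q /=.
by rewrite addbC.
Qed.

Lemma Ztensor_comm S T : comm_mx (Ztensor S) (Ztensor T).
Proof.
rewrite /comm_mx /Ztensor [LHS]tensor_mulmx [RHS]tensor_mulmx.
apply: eq_tensor => q.
by case: (S q) (T q) => [] [] /=; rewrite ?mul1mx ?mulmx1.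
Qed.

Lemma Xtensor_unit S : Xtensor S \in unitmx.
Proof.
suff /mulmx1_unit[] : Xtensor S *m Xtensor S = 1%:M by [].
by rewrite Xtensor_mul -tensor1; apply: eq_tensor => q; rewrite /= addbb.
Qed.

Lemma Ztensor_unit S : Ztensor S \in unitmx.
Proof.
suff /mulmx1_unit[] : Ztensor S *m Ztensor S = 1%:M by [].
rewrite [LHS]tensor_mulmx -tensor1; apply: eq_tensor => q.
by case: (S q) => /=; rewrite ?mulZZ ?mulmx1.
Qed.

Lemma eq_Xtensor S T : S =1 T -> Xtensor S = Xtensor T.
Proof. by move=> eqST; apply: eq_tensor => q; rewrite eqST. Qed.

Lemma single_qubitX (q : qubit L) :
  single_qubit C q PX = Xtensor (fun r => r == q).
Proof. by []. Qed.

Lemma two_qubitXI (u : site L) :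
  two_qubit C PX PI u = single_qubit C (u, false) PX.
Proof. by apply: eq_tensor => -[r []]; rewrite xpair_eqE /= ?andbT ?andbF ?if_same. Qed.

Lemma two_qubitIX (u : site L) :
  two_qubit C PI PX u = single_qubit C (u, true) PX.
Proof. by apply: eq_tensor => -[r []]; rewrite xpair_eqE /= ?andbT ?andbF ?if_same. Qed.

Lemma two_qubitXX (u : site L) : two_qubit C PX PX u =
  single_qubit C (u, false) PX *m single_qubit C (u, true) PX.
Proof.
rewrite !single_qubitX Xtensor_mul.
by apply: eq_tensor => -[r []]; rewrite !xpair_eqE /= ?andbT ?andbF ?addbF;
  case: eqP.
Qed.

Lemma two_qubitZ (b c : bool) (u : site L) :
  two_qubit C (if b then PZ else PI) (if c then PZ else PI) u
  = Ztensor (fun r => (r.1 == u) && (if r.2 then c else b)).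
Proof.
by apply: eq_tensor => -[r []] /=; case: eqP => //=; case: b; case: c.
Qed.

(** Recording the sign as a boolean makes it additive over F_2 in each argument, so that commutation
    with a long product becomes a parity count. *)
Definition sign_comm (b : bool) (A B : operator C L) :=
  A *m B = (-1) ^+ b *: (B *m A).

Lemma sign_commF A B : sign_comm false A B <-> comm_mx A B.
Proof. by rewrite /sign_comm expr0 scale1r. Qed.

Lemma sign_comm_mull b c A A' B :
  sign_comm b A B -> sign_comm c A' B -> sign_comm (b (+) c) (A *m A') B.
Proof.
rewrite /sign_comm => AB A'B.
by rewrite -mulmxA A'B -scalemxAr (mulmxA A) AB -scalemxAl scalerA mulmxA
  addbC signr_addb.
Qed.

Lemma sign_comm_mulr b c A B B' :
  sign_comm b A B -> sign_comm c A B' -> sign_comm (b (+) c) A (B *m B').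
Proof.
rewrite /sign_comm => AB AB'.
by rewrite mulmxA AB -scalemxAl -(mulmxA B) AB' -scalemxAr scalerA mulmxA
  signr_addb.
Qed.

Lemma operator_unit_neq0 (A : operator C L) : A \in unitmx -> A != 0.
Proof.
move=> Au; apply/eqP => A0; have := mulmxV Au; rewrite A0 mul0mx.
(* The zero configuration shows that the matrices have positive size, so that [1%:M] is nonzero. *)
set i : 'I_#|{: config L}| := enum_rank [ffun=> 0].
by move=> /matrixP/(_ i i)/eqP; rewrite !mxE eqxx eq_sym oner_eq0.
Qed.

(** The product of invertible operators is nonzero and 1 differs from -1, so the sign is
    determined. *)
Lemma sign_comm_inj b c A B : A \in unitmx -> B \in unitmx ->
  sign_comm b A B -> sign_comm c A B -> b = c.
Proof.
rewrite /sign_comm => Au Bu -> /eqP.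
rewrite -subr_eq0 -scalerBl scaler_eq0 subr_eq0 (inj_eq signr_inj) => /orP[/eqP//|].
by rewrite (negbTE (operator_unit_neq0 _ _)) // unitmx_mul Bu.
Qed.

Lemma sign_comm_Z_single S (q : qubit L) :
  sign_comm (S q) (Ztensor S) (single_qubit C q PX).
Proof.
rewrite /sign_comm /Ztensor /single_qubit.
(* The global sign is written as a product over qubits so that the tensor factor at [q] absorbs
   it. *)
have -> : ((-1) ^+ S q : C) = \prod_r (if r == q then (-1) ^+ S q else 1).
  by rewrite (bigD1 q) //= eqxx big1 ?mulr1 // => r /negbTE->.
rewrite [LHS]tensor_mulmx [X in _ *: X]tensor_mulmx -tensor_scale.
apply: eq_tensor => r; have [-> | _] := eqVneq r q.
  by case: (S q) => /=; rewrite ?mulZX ?scaleN1r // mul1mx mulmx1 expr0 scale1r.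
by rewrite /= mul1mx mulmx1 scale1r.
Qed.

End TensorProducts.

(** * Commutation of the generators with [E^(p)_u] *)

Section Code.
Variables (C : numClosedFieldType) (L : nat).
Implicit Types (u v w s : site L) (p k : nat) (l : seq (site L)).

Notation dx p := (ex L *+ 2 ^ p).
Notation dy p := (ey L *+ 2 ^ p).
Notation dz p := (ez L *+ 2 ^ p).

(** The coefficient of [v] in [w (1 + x^(2^p) + y^(2^p) + z^(2^p))] over F_2. With exclusive or,
    coinciding points cancel, as they must when [2^p = L]. *)
Definition tetrahedron p w v : bool :=
  (v == w) (+) (v == w + dx p) (+) (v == w + dy p) (+) (v == w + dz p).

(** This is the Frobenius identity: in the square of a four-term sum, each cross term occurs twice
    and cancels. *)
Lemma tetrahedronS p w v :
  tetrahedron p.+1 w v = tetrahedron p w v (+) tetrahedron p (w + dx p) v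
    (+) tetrahedron p (w + dy p) v (+) tetrahedron p (w + dz p) v.
Proof.
rewrite /tetrahedron !expnS !mul2n -!addnn !mulrnDr.
move: (dx p) (dy p) (dz p) => a b c.
rewrite !addrA (addrAC w b a) (addrAC w c a) (addrAC w c b).
by do 10 case: (v == _).
Qed.

(** The label of the cube whose vertex farthest from its base vertex is [u]. *)
Definition corner u : site L := u - ex L - ey L - ez L.

Lemma cornerD u w : corner (u + w) = corner u + w.
Proof. by rewrite /corner !(addrAC _ w). Qed.

Lemma Zgen_unit v : Zgen C v \in unitmx.
Proof.
have Z b c w := two_qubitZ C L b c w.
rewrite /Zgen (Z true false) (Z true false) (Z true false).
by rewrite (Z true true) !(Z false true) !unitmx_mul !Ztensor_unit.
Qed.

Lemma Zgen_comm_single v s : sign_comm C L (tetrahedron 0 (corner s) v)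
  (Zgen C v) (single_qubit C (s, false) PX).
Proof.
(* One term for each factor of [Zgen], in order; the three [false] are the [IZ] factors, which miss
   the first qubit of [s]. *)
have -> : tetrahedron 0 (corner s) v =
  (s == v + ex L + ey L) (+) (s == v + ex L + ez L) (+) (s == v + ey L + ez L)
  (+) false (+) false (+) false (+) (s == v + ex L + ey L + ez L).
  rewrite !addbF /tetrahedron /corner !expn0 !mulr1n.
  move: (ex L) (ey L) (ez L) => x y z.
  have subCE t a b : (t == s - a - b) = (s == t + a + b).
    by rewrite eq_sym !subr_eq addrAC.
  have -> : s - x - y - z + x = s - y - z.
    by rewrite (addrAC _ (- z)) (addrAC _ (- y)) subrK.
  have -> : s - x - y - z + y = s - x - z by rewrite (addrAC _ (- z)) subrK.
  have -> : (v == s - x - y - z) = (s == v + x + y + z).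
    by rewrite eq_sym subr_eq eq_sym subCE (addrAC v z) (addrAC _ z).
  rewrite subrK !subCE.
  by do 4 case: (s == _).
have Z b c w := two_qubitZ C L b c w.
rewrite /Zgen (Z true false) (Z true false) (Z true false).
rewrite (Z true true) !(Z false true).
have XZ (b c : bool) w (d : bool) : (s == w) && b = d ->
    sign_comm C L d (Ztensor C L (fun r => (r.1 == w) && (if r.2 then c else b)))
      (single_qubit C (s, false) PX).
  by move=> <-; exact: sign_comm_Z_single.
by do !apply: sign_comm_mull; apply: XZ; rewrite ?andbT ?andbF.
Qed.

Lemma Eop_Xtensor p u : exists S, Eop C p u = Xtensor C L S.
Proof.
elim: p u => [|p IHp] u /=.
  by exists (fun r => r == (u, false)); rewrite two_qubitXI.
have [S1 ->] := IHp u; have [S2 ->] := IHp (u + dx p).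
have [S3 ->] := IHp (u + dy p); have [S4 ->] := IHp (u + dz p).
by rewrite !Xtensor_mul; eexists.
Qed.

Lemma Eop_unit p u : Eop C p u \in unitmx.
Proof. by have [S ->] := Eop_Xtensor p u; exact: Xtensor_unit. Qed.

Lemma Xgen_Xtensor v : exists S, Xgen C v = Xtensor C L S.
Proof.
by rewrite /Xgen !two_qubitXI !two_qubitIX two_qubitXX !single_qubitX !Xtensor_mul;
  eexists.
Qed.

Lemma Zgen_comm_Eop p u v :
  sign_comm C L (tetrahedron p (corner u) v) (Zgen C v) (Eop C p u).
Proof.
elim: p u => [|p IHp] u /=.
  by rewrite two_qubitXI; exact: Zgen_comm_single.
by rewrite tetrahedronS -!cornerD; do !apply: sign_comm_mulr.
Qed.

(** * The sequence of single-qubit operators and its syndromes *)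

Fixpoint Efactors p u : seq (site L) :=
  match p with
  | 0%N => [:: u]
  | p'.+1 => Efactors p' u ++ Efactors p' (u + dx p')
      ++ Efactors p' (u + dy p') ++ Efactors p' (u + dz p')
  end.

Definition Xpath l : seq (qubit L * pauli) := [seq ((s, false), PX) | s <- l].

Lemma path_op_cat (a b : seq (qubit L * pauli)) :
  path_op C (a ++ b) = path_op C b *m path_op C a.
Proof. by elim: a => [|q a IHa] /=; rewrite ?mulmx1 // IHa mulmxA. Qed.

Lemma path_op_Efactors p u : path_op C (Xpath (Efactors p u)) = Eop C p u.
Proof.
elim: p u => [|p IHp] u /=; first by rewrite mul1mx two_qubitXI.
rewrite /Xpath !map_cat !path_op_cat !IHp.
have [S1 ->] := Eop_Xtensor p u; have [S2 ->] := Eop_Xtensor p (u + dx p).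
have [S3 ->] := Eop_Xtensor p (u + dy p).
have [S4 ->] := Eop_Xtensor p (u + dz p).
(* The path multiplies the four copies in reverse order, which is harmless because products of [X]
   commute. *)
rewrite !Xtensor_mul; apply: eq_Xtensor => q.
by case: (S1 q) (S2 q) (S3 q) (S4 q) => [] [] [] [].
Qed.

Definition syndrome l v : bool := \big[addb/false]_(s <- l) tetrahedron 0 (corner s) v.

Lemma syndrome_cat l1 l2 v :
  syndrome (l1 ++ l2) v = syndrome l1 v (+) syndrome l2 v.
Proof. exact: big_cat. Qed.

Lemma syndrome_Efactors p u v :
  syndrome (Efactors p u) v = tetrahedron p (corner u) v.
Proof.
elim: p u => [|p IHp] u /=; first by rewrite /syndrome big_seq1.
by rewrite !syndrome_cat !IHp tetrahedronS !cornerD !addbA.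
Qed.

Lemma Zgen_comm_path l v :
  sign_comm C L (syndrome l v) (Zgen C v) (path_op C (Xpath l)).
Proof.
elim: l => [|s l IHl] /=.
  by rewrite /syndrome big_nil /sign_comm expr0 scale1r mulmx1 mul1mx.
rewrite /syndrome big_cons addbC.
by apply: sign_comm_mulr => //; exact: Zgen_comm_single.
Qed.

Lemma path_Xtensor l : exists S, path_op C (Xpath l) = Xtensor C L S.
Proof.
elim: l => [|s l [S IHl]] /=; first by exists (fun=> false); rewrite -tensor1.
by rewrite IHl single_qubitX Xtensor_mul; eexists.
Qed.

(** * Counting the defects along the sequence *)

Definition weight (f : site L -> bool) : nat := #|[set v | f v]|.

Lemma eq_weight f g : f =1 g -> weight f = weight g.
Proof. by move=> fg; apply: eq_card => v; rewrite !inE fg. Qed.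

Lemma weight_addb f g : (weight (fun v => f v (+) g v) <= weight f + weight g)%N.
Proof.
apply: leq_trans (leq_card_setU [set v | f v] [set v | g v]).
apply/subset_leq_card/subsetP => v; rewrite !inE.
by case: (f v) (g v) => [] [].
Qed.

Lemma weight_addb_le f g m n : (weight f <= m)%N -> (weight g <= n)%N ->
  (weight (fun v => f v (+) g v) <= m + n)%N.
Proof. by move=> fm gn; apply: leq_trans (weight_addb f g) (leq_add fm gn). Qed.

Lemma weight_point w : (weight (fun v => v == w) <= 1)%N.
Proof. by rewrite /weight cardsE card1. Qed.

Lemma weight_points4 w1 w2 w3 w4 :
  (weight (fun v => (v == w1) (+) (v == w2) (+) (v == w3) (+) (v == w4)) <= 4)%N.
Proof.
by apply: (weight_addb_le _ _ 3 1); [apply: (weight_addb_le _ _ 2 1);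
  [apply: (weight_addb_le _ _ 1 1)|]|]; exact: weight_point.
Qed.

(** Adding the base point to the syndrome makes each level of the recursion cost only 4. The segment
    has to be proper: for [p = 0] the complete one would leave three points. *)
Lemma weight_prefix p u k : (k < size (Efactors p u))%N ->
  (weight (fun v => (v == corner u) (+) syndrome (take k (Efactors p u)) v)
     <= 1 + 4 * p)%N.
Proof.
elim: p u k => [|p IHp] u k /=.
  rewrite ltnS leqn0 => /eqP->; rewrite take0 muln0.
  rewrite (eq_weight _ (fun v => v == corner u)); first exact: weight_point.
  by move=> v; rewrite /syndrome big_nil addbF.
(* Here [w] is the base site of the copy under construction and [g] is what the completed copies
   leave once both base points are accounted for. *)
have shift f (g : site L -> bool) w j : (j < size (Efactors p w))%N ->
    (weight g <= 4)%N ->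
    f =1 (fun v => g v (+) ((v == corner w) (+)
       syndrome (take j (Efactors p w)) v)) ->
    (weight f <= 1 + 4 * p.+1)%N.
  move=> /IHp le_j g4 /eq_weight->.
  by apply: leq_trans (weight_addb_le _ _ _ _ g4 le_j) _; rewrite mulnS addnCA.
rewrite !take_cat !size_cat => lt_k.
case: ltnP => [lt | leA].
  by apply: leq_trans (IHp _ _ lt) _; rewrite leq_add2l leq_mul2l leqnSn orbT.
(* Copy at [u + dx p]: the first copy leaves only its y and z points. *)
case: ltnP => [lt | leB].
  apply: (shift _ (fun v => (v == corner u + dy p)
    (+) (v == corner u + dz p)) _ _ lt).
    apply: (@leq_trans 2) => //.
    by apply: (weight_addb_le _ _ 1 1); exact: weight_point.
  move=> v; rewrite !syndrome_cat !syndrome_Efactors !cornerD /tetrahedron.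
  case: (syndrome _ _); move: (corner u) (dx p) (dy p) (dz p) => w x y z;
    by do 4 case: (v == _).
(* Copy at [u + dy p]: the x point shared by the two completed copies cancels, and four points
   remain. *)
case: ltnP => [lt | leC].
  apply: (shift _ (fun v => (v == corner u + dx p + dx p)
    (+) (v == corner u + dz p) (+) (v == corner u + dx p + dy p)
    (+) (v == corner u + dx p + dz p)) _ _ lt).
    exact: weight_points4.
  move=> v; rewrite !syndrome_cat !syndrome_Efactors !cornerD /tetrahedron.
  case: (syndrome _ _); move: (corner u) (dx p) (dy p) (dz p) => w x y z;
    by do 7 case: (v == _).
(* Last copy: the xy point shared by the second and third copies cancels as well, so there are again
   four points. *)
have lt : (k - size (Efactors p u) - size (Efactors p (u + dx p)%R)
  - size (Efactors p (u + dy p)%R) < size (Efactors p (u + dz p)%R))%N by lia.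
apply: (shift _ (fun v => (v == corner u + dx p + dx p)
  (+) (v == corner u + dy p + dy p) (+) (v == corner u + dx p + dz p)
  (+) (v == corner u + dy p + dz p)) _ _ lt).
  exact: weight_points4.
move=> v; rewrite !syndrome_cat !syndrome_Efactors !cornerD /tetrahedron.
case: (syndrome _ _); move: (corner u) (dx p) (dy p) (dz p) => w x y z;
  by rewrite (addrAC w y x); do 9 case: (v == _).
Qed.

Lemma weight_path p u k : (weight (syndrome (take k (Efactors p u))) <= 4 + 4 * p)%N.
Proof.
have [lt_k | le_k] := ltnP k (size (Efactors p u)).
  rewrite -(eq_weight (fun v => (v == corner u) (+) ((v == corner u) (+)
     syndrome (take k (Efactors p u)) v))); last by move=> v; rewrite addKb.
  (* Removing the base point again costs at most 1, for a total of [2 + 4 * p]. *)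
  apply: leq_trans (weight_addb_le _ _ _ _ (weight_point _) (weight_prefix _ _ _ lt_k)) _.
  by rewrite addnA leq_add2r.
rewrite take_oversize // (eq_weight _ _ (syndrome_Efactors p u)).
exact: leq_trans (weight_points4 _ _ _ _) (leq_addr _ _).
Qed.

Lemma comm_mx_sign b (A B : operator C L) : A \in unitmx -> B \in unitmx ->
  sign_comm C L b A B -> (A *m B == - (B *m A)) = b.
Proof.
move=> Au Bu AB; apply/idP/idP => [/eqP eqN|b1].
  apply/esym/(sign_comm_inj _ _ true _ _ _ Au Bu _ AB).
  by rewrite /sign_comm eqN expr1 scaleN1r.
by rewrite AB b1 expr1 scaleN1r.
Qed.

(** Products of [X] commute with every X-type generator, so only Z-type generators can be
    defects. *)
Lemma defects_path l :
  defects (path_op C (Xpath l)) = [set inl v | v in [set v | syndrome l v]].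
Proof.
have [S pathS] := path_Xtensor l.
apply/setP=> -[v|v]; rewrite inE /=.
  rewrite mem_imset ?inE; last by move=> ? ? [].
  apply: comm_mx_sign (Zgen_comm_path l v); first exact: Zgen_unit.
  by rewrite pathS Xtensor_unit.
have [T ->] := Xgen_Xtensor v; rewrite pathS.
rewrite (comm_mx_sign false) ?Xtensor_unit //.
  by apply/esym/imsetP => -[].
by apply/sign_commF; exact: Xtensor_comm.
Qed.

(** * A plane of [ZI] operators that separates [E^(n)_u] from the stabilizers *)

Definition Zplane (c : 'Z_L) : operator C L :=
  Ztensor C L (fun q => ~~ q.2 && (q.1.2 == c)).

Lemma Zplane_unit c : Zplane c \in unitmx.
Proof. exact: Ztensor_unit. Qed.

Lemma Zplane_comm_Zgen c v : comm_mx (Zplane c) (Zgen C v).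
Proof.
have Z b1 b2 w := two_qubitZ C L b1 b2 w.
rewrite /Zgen (Z true false) (Z true false) (Z true false).
rewrite (Z true true) !(Z false true).
by do !apply: comm_mxM; exact: Ztensor_comm.
Qed.

(** On first qubits, an X-type generator acts at two sites at the height of [v] and at two sites one
    step higher, so it meets every horizontal plane evenly. *)
Lemma Zplane_comm_Xgen c v : comm_mx (Zplane c) (Xgen C v).
Proof.
apply/sign_commF.
pose b (r : site L) : bool := r.2 == c.
have -> : false = b (v + ex L + ey L) (+) b (v + ex L + ez L) (+) b (v + ey L + ez L)
  (+) false (+) false (+) false (+) (b v (+) false).
  rewrite !addbF /b /= !addr0.
  by do 2 case: (_ == c).
rewrite /Xgen !two_qubitXI !two_qubitIX two_qubitXX.
by do !apply: sign_comm_mulr; exact: sign_comm_Z_single.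
Qed.

Lemma Zplane_comm_stabilizer c M : stabilizer M -> comm_mx (Zplane c) M.
Proof.
elim=> [[v|v]||A B _ IHA _ IHB|A _ IHA] /=.
- exact: Zplane_comm_Zgen.
- exact: Zplane_comm_Xgen.
- exact: comm_mx1.
- exact: comm_mxM.
(* On a singular matrix [invmx] is the identity map, so the induction hypothesis suffices. *)
have [Au|] := boolP (A \in unitmx); last by rewrite /invmx => /negbTE->.
have := congr1 (fun B => invmx A *m B *m invmx A) IHA.
by rewrite mulKmx // -!mulmxA mulmxV // mulmx1 => /esym.
Qed.

Lemma Zplane_comm_Eop c p u :
  sign_comm C L (\big[addb/false]_(i < 2 ^ p) (u.2 + i%:R == c))
    (Zplane c) (Eop C p u).
Proof.
elim: p u => [|p IHp] u /=.
  rewrite two_qubitXI big_ord1 addr0.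
  exact: (sign_comm_Z_single _ _ (fun q => ~~ q.2 && (q.1.2 == c)) (u, false)).
rewrite expnS mul2n -addnn big_split_ord /=.
set b := \big[_/_]_(i < _) _; set b' := \big[_/_]_(i < _) _.
(* The x and y translates lie at the same heights as the original copy: three equal parities reduce
   to one, and only the z translate gives the upper half [b']. *)
have -> : b (+) b' = b (+) b (+) b (+) b' by rewrite addbb.
apply: sign_comm_mulr; last first.
  have := IHp (u + dz p); congr sign_comm; apply: eq_bigr => i _.
  by rewrite natrD addrA pairMnE.
do !apply: sign_comm_mulr; first exact: IHp.
  have := IHp (u + dx p); congr sign_comm; apply: eq_bigr => i _.
  by rewrite /= pairMnE /= mul0rn addr0.
have := IHp (u + dy p); congr sign_comm; apply: eq_bigr => i _.
by rewrite /= pairMnE /= mul0rn addr0.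
Qed.

End Code.

(* trunc_log 2 L is exactly log_2 L here, L being a power of 2. *)
Theorem mainTheorem4 (C : numClosedFieldType) (n L : nat) (n_ge1 : (1 <= n)%N)
    (L_def : L = (2 ^ n)%N) (u : site L) :
  is_logical (Eop C n u) /\
  energy_barrier_le (Eop C n u) (4 + 4 * trunc_log 2 L)%N.
Proof.
have L_gt1 : (1 < L)%N by rewrite L_def -{1}(expn0 2) ltn_exp2l.
have logL : trunc_log 2 L = n by rewrite L_def trunc_expnK.
have [S ES] := Eop_Xtensor C L n u.
split; last first.
  exists (Xpath L (Efactors L n u)); split; first exact: path_op_Efactors.
  move=> k _; rewrite logL -map_take defects_path.
  apply: leq_trans (leq_imset_card _ _) _; exact: weight_path.
split.
- by exists 1, (fun q => if S q then PX else PI); rewrite expr1n scale1r.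
- case=> v /=; last first.
    by have [T ->] := Xgen_Xtensor C L v; rewrite ES; exact: Xtensor_comm.
  have := Zgen_comm_Eop C L n u v.
  (* Translation by [L] is trivial on the torus, so the four points of the tetrahedron coincide and
     cancel. *)
  have dL (w : site L) : w *+ 2 ^ n = 0.
    have dZ (a : 'Z_L) : a *+ 2 ^ n = 0.
      by rewrite -L_def -mulr_natr pchar_Zp // mulr0.
    by rewrite pairMnE pairMnE !dZ.
  rewrite /tetrahedron !dL !addr0 addbb addbb /=.
  by move/sign_commF.
move=> c c1 stab.
have c0 : c != 0 by rewrite -normr_eq0 c1 oner_eq0.
have := Zplane_comm_stabilizer C L u.2 _ stab.
rewrite /comm_mx -scalemxAl -scalemxAr => /(scalerI c0) comm.
have := Zplane_comm_Eop C L u.2 n u.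
rewrite -L_def.
(* The heights [u.2 + i] for [i < L] are distinct modulo [L], so only [i = 0] counts and the parity
   is odd. *)
have -> : \big[addb/false]_(i < L) (u.2 + i%:R == u.2) = true.
  rewrite (bigD1 (Ordinal (ltnW L_gt1))) //= addr0 eqxx big1 // => i i0.
  rewrite -subr_eq0 addrAC subrr add0r -val_eqE /= val_Zp_nat // modn_small //.
  exact: negbTE i0.
move=> anti; suff : true = false by [].
apply: (sign_comm_inj _ _ _ _ _ _ (Zplane_unit _ _ _) (Eop_unit _ _ _ _) anti).
by apply/sign_commF.
Qed.
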